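(* Every known $3$-multiperfect number is $3$-layered; that is, each of the six numbers $120=2^3\cdot3\cdot5$, $672=2^5\cdot3\cdot7$, $523776=2^9\cdot3\cdot11\cdot31$, $459818240=2^8\cdot5\cdot7\cdot19\cdot37\cdot73$, $1476304896=2^{13}\cdot3\cdot11\cdot43\cdot127$, $51001180160=2^{14}\cdot5\cdot7\cdot19\cdot31\cdot151$ is $3$-layered.
   Context: $\sigma(n)$ denotes the sum of the positive divisors of $n$. A positive integer $n$ is $k$-multiperfect if $\sigma(n)=kn$. Exactly six $3$-multiperfect numbers are known, namely those listed in the claim. A positive integer $n$ is $3$-layered if the set of all positive divisors of $n$ can be partitioned into $3$ subsets having the same sum of elements. *)

(* Defs.v *)
From Stdlib Require Import BinNat.
From mathcomp Require Import all_boot.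
From mathcomp Require Import zify.

Set Implicit Arguments.
Unset Strict Implicit.
Unset Printing Implicit Defensive.

Definition sigma (n : nat) : nat := \sum_(d <- divisors n) d.

Definition multiperfect (k n : nat) : Prop := 0 < n /\ sigma n = k * n.

(* Every divisor of n > 0 is at most n, so 'I_n.+1 is a large enough finType. *)
Definition divisor_set (n : nat) : {set 'I_n.+1} :=
  [set d : 'I_n.+1 | (d : nat) \in divisors n].

(* The blocks of a partition are nonempty and pairwise disjoint, so #|P| = k
   says that there are exactly k of them. Nonemptiness is no restriction here:
   sigma n > 0, so k subsets with equal sums cannot include an empty one. *)
Definition layered (k n : nat) : Prop :=
  0 < n /\
  exists P : {set {set 'I_n.+1}},
    [/\ partition P (divisor_set n), #|P| = k &
        exists s : nat, forall A, A \in P -> \sum_(d in A) (d : nat) = s].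

(* The numerals are binary (type N), as unary ones would be too large. *)
Definition known_3multiperfect : seq nat :=
  [:: 120%num : nat; 672%num : nat; 523776%num : nat; 459818240%num : nat;
      1476304896%num : nat; 51001180160%num : nat].

Lemma known_3multiperfect_factor :
  known_3multiperfect =
    [:: 2 ^ 3 * 3 * 5;
        2 ^ 5 * 3 * 7;
        2 ^ 9 * 3 * 11 * 31;
        2 ^ 8 * 5 * 7 * 19 * 37 * 73;
        2 ^ 13 * 3 * 11 * 43 * 127;
        2 ^ 14 * 5 * 7 * 19 * 31 * 151].
Proof.
have E1 : 120%num = 2 ^ 3 * 3 * 5 :> nat by lia.
have E2 : 672%num = 2 ^ 5 * 3 * 7 :> nat by lia.
have E3 : 523776%num = 2 ^ 9 * 3 * 11 * 31 :> nat by lia.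
have E4 : 459818240%num = 2 ^ 8 * 5 * 7 * 19 * 37 * 73 :> nat by lia.
have E5 : 1476304896%num = 2 ^ 13 * 3 * 11 * 43 * 127 :> nat by lia.
have E6 : 51001180160%num = 2 ^ 14 * 5 * 7 * 19 * 31 * 151 :> nat by lia.
exact (f_equal2 cons E1 (f_equal2 cons E2 (f_equal2 cons E3 (f_equal2 cons E4
  (f_equal2 cons E5 (f_equal2 cons E6 (erefl [::]))))))).
Qed.

Lemma sigma_mul m n : coprime m n -> 0 < m -> 0 < n ->
  sigma (m * n) = sigma m * sigma n.
Proof.
move=> cmn m0 n0.
have -> : sigma m * sigma n =
          \sum_(d <- [seq d * e | d <- divisors m, e <- divisors n]) d.
  by rewrite big_allpairs_dep /= big_distrl; apply: eq_bigr => d _; rewrite big_distrr.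
apply/perm_big/uniq_perm; first exact: divisors_uniq.
- apply: allpairs_uniq_dep; first exact: divisors_uniq.
    by move=> *; exact: divisors_uniq.
  move=> _ _ /allpairsPdep[x [y [+ + ->]]] /allpairsPdep[x' [y' [+ + ->]]] /=.
  rewrite -!dvdn_divisors // => xm yn x'm y'n E.
  have F u v : u %| m -> v %| n -> gcdn (u * v) m = u.
    move=> um vn; rewrite -(gcdnC m) Gauss_gcdl; first by rewrite gcdnC; apply/gcdn_idPl.
    exact: coprime_dvdr vn cmn.
  have G u v : u %| m -> v %| n -> gcdn (u * v) n = v.
    move=> um vn; rewrite -(gcdnC n) Gauss_gcdr; first by rewrite gcdnC; apply/gcdn_idPl.
    by rewrite coprime_sym; apply: coprime_dvdl um cmn.
  have <- : x = x' by rewrite -(F x y) // E F.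
  by have <- : y = y' by rewrite -(G x y) // E G.
move=> d; rewrite -dvdn_divisors ?muln_gt0 ?m0 //.
apply/idP/allpairsP => [dmn | [[x y] /= [+ + ->]]].
  exists (gcdn d m, gcdn d n); rewrite -!dvdn_divisors //= !dvdn_gcdr; split=> //.
  apply/eqP; rewrite eqn_dvd; apply/andP; split.
    rewrite muln_gcdl !muln_gcdr !dvdn_gcd dmn (mulnC m d).
    by rewrite !(dvdn_mulr _ (dvdnn d)).
  rewrite Gauss_dvd ?dvdn_gcdl //.
  by apply: coprime_dvdl (dvdn_gcdr _ _) (coprime_dvdr (dvdn_gcdr _ _) cmn).
by rewrite -!dvdn_divisors //; apply: dvdn_mul.
Qed.

Lemma sigma_prime_exp p k : prime p -> sigma (p ^ k) = \sum_(i < k.+1) p ^ i.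
Proof.
move=> pp; have p1 := prime_gt1 pp.
rewrite -(big_mkord xpredT (expn p)) -(big_map (expn p) xpredT id).
apply/perm_big/uniq_perm; first exact: divisors_uniq.
  by rewrite map_inj_uniq ?iota_uniq //; apply: expnI.
move=> d; rewrite -dvdn_divisors ?expn_gt0 ?prime_gt0 //.
apply/(dvdn_pfactor _ _ pp)/mapP => -[i ik ->]; exists i => //.
  by rewrite mem_index_iota.
by move: ik; rewrite mem_index_iota.
Qed.

Lemma sigma_prime p : prime p -> sigma p = p.+1.
Proof.
move=> pp; rewrite -[X in sigma X]expn1 sigma_prime_exp //.
by rewrite !big_ord_recl big_ord0 /= expn0 expn1 addn0 add1n. Qed.

Ltac sigma_step S :=
  rewrite S; [ | by [] | by rewrite ?coprimeMl ?coprimeXl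
               | by rewrite ?muln_gt0 ?expn_gt0 ].

Lemma known_3multiperfectP n :
  n \in known_3multiperfect -> multiperfect 3 n.
Proof.
rewrite known_3multiperfect_factor !inE /multiperfect.
have E k : sigma (2 ^ k) = 2 ^ k.+1 - 1.
  by rewrite sigma_prime_exp // subn1 predn_exp mul1n.
have S m p : prime p -> coprime m p -> 0 < m -> sigma (m * p) = sigma m * p.+1.
  by move=> pp cmp m0; rewrite (sigma_mul cmp m0 (prime_gt0 pp)) (sigma_prime pp).
move=> /or4P[|||/or3P[||]] /eqP->; (split; first by rewrite !muln_gt0 ?expn_gt0);
  [ do 2 sigma_step S | do 2 sigma_step S | do 3 sigma_step S | do 5 sigma_step S | do 4 sigma_step S | do 5 sigma_step S ];
  rewrite E; lia.
Qed.

(* Main.v *)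
Require Import Defs.
From Stdlib Require Import BinNat.
From mathcomp Require Import all_boot.

(** Since [sigma n = 3 * n], the block [{n}] already has the required sum, so it
    is enough to find proper divisors of [n] that add up to [n]; the remaining
    divisors then add up to [n] as well. Such proper divisors are inherited by
    multiples, so a divisor equal to 6 = 1 + 2 + 3 or 20 = 1 + 4 + 5 + 10
    suffices, and each of the six numbers has one. *)

(** Block sums run over ordinals, while [sigma] and the chosen divisors are given by lists; this
    translates between the two. The bound on [s] ensures that no entry falls outside ['I_m]. *)
Lemma sum_ord_mem (m : nat) (s : seq nat) : uniq s -> {in s, forall d, d < m} ->
  \sum_(d < m | (d : nat) \in s) (d : nat) = \sum_(d <- s) d.
Proof.
move=> s_uniq s_lt; rewrite -(big_mkord (mem s) id) -big_filter.
apply/perm_big/uniq_perm => // [|d]; first by rewrite filter_uniq ?iota_uniq.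
by rewrite mem_filter mem_index_iota /=; case: (boolP (d \in s)) => // /s_lt.
Qed.

(** The blocks [B] and [A] are added in turn to [[set C]]. A block disjoint from all the nonempty
    blocks already present differs from each of them, which gives the count. *)
Lemma partition3 (T : finType) (A B C : {set T}) :
  A != set0 -> B != set0 -> C != set0 ->
  [disjoint A & B] -> [disjoint A & C] -> [disjoint B & C] ->
  partition [set A; B; C] (A :|: B :|: C) /\ #|[set A; B; C]| = 3.
Proof.
move=> A0 B0 C0 dAB dAC dBC.
have C1 : trivIset [set C] by rewrite /trivIset /cover !big_set1.
have C1n0 : set0 \notin [set C] by rewrite inE eq_sym.
have [|BC_triv BnC] := trivIsetU1 (A := B) _ C1 C1n0; first by move=> X /set1P->.
have BCn0 : set0 \notin [set B; C] by rewrite !inE !(eq_sym set0) negb_or B0.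
have [|ABC_triv AnBC] := trivIsetU1 (A := A) _ BC_triv BCn0.
  by move=> X /set2P[]->.
have -> : [set A; B; C] = A |: [set B; C] by rewrite setUA.
split; last by rewrite cardsU1 AnBC cardsU1 BnC cards1.
rewrite /partition ABC_triv !inE !(eq_sym set0) !negb_or A0 B0 C0 !andbT.
by rewrite /cover big_setU1 // big_setU1 // big_set1 /= setUA.
Qed.

Lemma layered3_of_semiperfect (n : nat) (s : seq nat) :
  multiperfect 3 n -> uniq s -> {in s, forall d, d %| n /\ d < n} ->
  \sum_(d <- s) d = n -> layered 3 n.
Proof.
move=> [n_gt0 sigma_n] s_uniq s_proper sum_s; split=> //.
(* In ['I_n.+1] the element [ord_max] is [n] itself. Strictness of [d < n] on [s] keeps it out of
   [A]. *)
pose N : {set 'I_n.+1} := [set ord_max].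
pose A := [set d : 'I_n.+1 | (d : nat) \in s].
pose C := divisor_set n :\: (N :|: A).
have sumN : \sum_(d in N) (d : nat) = n by rewrite big_set1.
have sumA : \sum_(d in A) (d : nat) = n.
  rewrite -[RHS]sum_s -(@sum_ord_mem n.+1 s) //; last first.
    by move=> d /s_proper[_ /ltnW].
  by apply: eq_bigl => d; rewrite inE.
have dNA : [disjoint N & A].
  rewrite disjoints1 inE /=; apply/negP => /s_proper[_].
  by rewrite ltnn.
have sumNA : \sum_(d in N :|: A) (d : nat) = n + n.
  transitivity (\sum_(d in N) (d : nat) + \sum_(d in A) (d : nat));
    last by rewrite sumN sumA.
  rewrite -bigU //=.
  by apply: eq_bigl => d; rewrite inE.
have NA_sub : N :|: A \subset divisor_set n.
  apply/subsetP => d; rewrite !inE -dvdn_divisors // => /orP[/eqP-> //|].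
  by case/s_proper.
have sumD : \sum_(d in divisor_set n) (d : nat) = 3 * n.
  rewrite -sigma_n /sigma -(@sum_ord_mem n.+1) ?divisors_uniq //.
    by apply: eq_bigl => d; rewrite inE.
  by move=> d; rewrite -dvdn_divisors // ltnS; apply: dvdn_leq.
have sumC : \sum_(d in C) (d : nat) = n.
  move: sumD; rewrite (big_setID (N :|: A)) /= (setIidPr NA_sub).
  by rewrite sumNA -/C mulSn mul2n -addnn addnA => /addnI.
(* Each block has sum [n > 0], and an empty block would have sum 0. *)
have nonempty (X : {set 'I_n.+1}) : \sum_(d in X) (d : nat) = n -> X != set0.
  by apply: contra_eqN => /eqP->; rewrite big_set0 eq_sym -lt0n.
have dNAC : [disjoint N :|: A & C] by rewrite -setI_eq0 setIDA setDIl setDv set0I.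
have dNC : [disjoint N & C] by apply: disjointWl dNAC; apply: subsetUl.
have dAC : [disjoint A & C] by apply: disjointWl dNAC; apply: subsetUr.
have [part card3] := @partition3 _ N A C (nonempty _ sumN) (nonempty _ sumA)
  (nonempty _ sumC) dNA dNC dAC.
exists [set N; A; C]; split=> //.
  suff <- : N :|: A :|: C = divisor_set n by [].
  by rewrite -[RHS](setID _ (N :|: A)) (setIidPr NA_sub).
by exists n => X; rewrite !inE => /orP[/orP[]|] /eqP->.
Qed.

(** With [n = q * m] and [q > 0], multiplication by [q] is injective, sends proper divisors of [m]
    to proper divisors of [n], and scales their sum from [m] to [n]. *)
Lemma layered3_of_dvdn (m n : nat) (s : seq nat) :
  multiperfect 3 n -> m %| n -> uniq s -> {in s, forall d, d %| m /\ d < m} ->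
  \sum_(d <- s) d = m -> layered 3 n.
Proof.
move=> n_perf /dvdnP[q nE] s_uniq s_proper sum_s.
have q_gt0 : 0 < q by case: n_perf; rewrite nE muln_gt0 => /andP[].
apply: (@layered3_of_semiperfect n [seq q * d | d <- s]) => //.
- by rewrite map_inj_uniq // => x y /eqP; rewrite eqn_pmul2l // => /eqP.
- move=> _ /mapP[d /s_proper[dm ltdm] ->].
  by rewrite nE dvdn_pmul2l // ltn_pmul2l.
- by rewrite big_map -big_distrr /= sum_s.
Qed.

Lemma layered3_of_dvdn6 (n : nat) : multiperfect 3 n -> 6 %| n -> layered 3 n.
Proof.
move=> n_perf n6; apply: (@layered3_of_dvdn 6 n [:: 1; 2; 3]) => //.
  by move=> d; rewrite !inE => /or3P[] /eqP->.
by rewrite unlock.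
Qed.

Lemma layered3_of_dvdn20 (n : nat) : multiperfect 3 n -> 20 %| n -> layered 3 n.
Proof.
move=> n_perf n20; apply: (@layered3_of_dvdn 20 n [:: 1; 4; 5; 10]) => //.
  by move=> d; rewrite !inE => /or4P[] /eqP->.
by rewrite unlock.
Qed.

Theorem theorem6p8 :
  known_3multiperfect =
    [:: 2 ^ 3 * 3 * 5;
        2 ^ 5 * 3 * 7;
        2 ^ 9 * 3 * 11 * 31;
        2 ^ 8 * 5 * 7 * 19 * 37 * 73;
        2 ^ 13 * 3 * 11 * 43 * 127;
        2 ^ 14 * 5 * 7 * 19 * 31 * 151]
  /\ (forall n : nat, n \in known_3multiperfect -> layered 3 n).
Proof.
split=> [|n n_known]; first exact: known_3multiperfect_factor.
have n_perf := known_3multiperfectP n_known.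
(* The fourth and sixth numbers are not multiples of 3, so they go through 20; the other four go
   through 6. *)
suff /orP[] : (6 %| n) || (20 %| n).
- exact: layered3_of_dvdn6.
- exact: layered3_of_dvdn20.
have dvd6 k : 6 %| 2 ^ k.+1 * 3 by rewrite (@dvdn_mul 2 3) ?dvdn_exp.
have dvd20 k : 20 %| 2 ^ k.+2 * 5 by rewrite (@dvdn_mul 4 5) // (@dvdn_exp2l 2 2).
move: n_known; rewrite known_3multiperfect_factor !inE.
move=> /or4P[|||/or3P[||]] /eqP->; apply/orP.
(* Each [dvdn_mulr] drops the last prime factor, until [2 ^ a * 3] or [2 ^ a * 5] is left; the
   argument is then [a - 1] for [dvd6] and [a - 2] for [dvd20]. *)
- left; apply: dvdn_mulr; exact: dvd6 2.
- left; apply: dvdn_mulr; exact: dvd6 4.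
- left; do 2 apply: dvdn_mulr; exact: dvd6 8.
- right; do 4 apply: dvdn_mulr; exact: dvd20 6.
- left; do 3 apply: dvdn_mulr; exact: dvd6 12.
- right; do 4 apply: dvdn_mulr; exact: dvd20 12.
Qed.
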